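(* Let $M=(X,d_X)$ be a metric space with $\eta(M)>0$. Then for any metric space $M'=(Y,d_Y)$, $$\dim(M\circ M')=\sum_{x\in X}\dim(M'_x)+\sum_{\dot{x}\in X_Y}(|\dot{x}|-1),$$ where $X_Y$ is the set of those non-singleton twin equivalence classes $\dot{x}$ of $M$ such that for any $x\in\dot{x}$ and any metric basis $S_x$ of the gravitational space $M'_x$ there exists $z\in\{x\}\times Y$ whose distance in $M'_x$ to every $s\in S_x$ equals $\ell_x$.
   Context: All metric spaces considered have at least two points. The cardinality of any infinite set is written $+\infty$, and sums are taken in $[0,+\infty]$. Nearness and lexicographic metric space: for $M=(X,d_X)$ and $x\in X$, $\eta(x)=\inf\{d_X(x,y): y\in X\setminus\{x\}\}$ and $\eta(M)=\inf\{\eta(x): x\in X\}$. If $\eta(M)>0$ and $M'=(Y,d_Y)$ is a metric space, the lexicographic metric space is $M\circ M'=(X\times Y,\rho)$, where $\rho((x,y),(x',y'))=d_X(x,x')$ if $x\neq x'$, and $\rho((x,y),(x',y'))=\min\{2\eta(x),d_Y(y,y')\}$ if $x=x'$. For $x\in X$, the gravitational space $M'_x$ is the subspace of $M\circ M'$ on $Y_x=\{x\}\times Y$; its metric is $d_{\eta(x)}((x,y),(x,y'))=\min\{2\eta(x),d_Y(y,y')\}$. Metric dimension: a subset $A$ of a metric space $(Z,d)$ resolves it if for all $u,v\in Z$, $d(u,a)=d(v,a)$ for all $a\in A$ implies $u=v$. The metric dimension $\dim$ is the minimum cardinality of a resolving subset (in $\mathbb{N}\cup\{+\infty\}$), and a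 metric basis is a resolving subset whose cardinality equals $\dim$. Twins: points $a,b\in X$ are twins in $M$ if $d_X(a,c)=d_X(b,c)$ for every $c\in X\setminus\{a,b\}$. This is an equivalence relation on $X$; $\dot{x}$ denotes the class of $x$. In a non-singleton twin class $\dot{x}$ the distance between any two distinct elements is constant, and this constant is denoted $\ell_x$. *)

(* Defs.v *)
From HB Require Import structures.
From mathcomp Require Import all_boot all_order all_algebra.
From mathcomp Require Import all_classical all_reals all_analysis.
From mathcomp Require Import lra.

Set Implicit Arguments.
Unset Strict Implicit.
Unset Printing Implicit Defensive.

Import Order.TTheory GRing.Theory Num.Theory.
Local Open Scope classical_set_scope.
Local Open Scope ring_scope.

(* A subset Z of T stands for the subspace of T on Z; the whole space is
   [set: T]. *)
Section metric_dimension.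
Context {R : realType} {T : metricType R}.
Implicit Types Z A : set T.

Definition resolving_set Z A : Prop :=
  A `<=` Z /\
  forall u v, Z u -> Z v -> (forall a, A a -> mdist u a = mdist v a) -> u = v.

(* [counting A] is the number of elements of A, and +oo if A is infinite;
   hence the infimum is a minimum, see [metric_basis_exists]. *)
Definition metric_dim Z : \bar R :=
  ereal_inf [set counting A | A in resolving_set Z].

Definition metric_basis Z A : Prop :=
  resolving_set Z A /\ counting A = metric_dim Z.

Lemma resolving_setxx Z : resolving_set Z Z.
Proof.
split=> // u v Zu Zv /(_ v Zv); rewrite mdistxx; exact: mdist_positivity.
Qed.

Lemma metric_basis_exists Z : exists A, metric_basis Z A.
Proof.
have countingE A : counting A = +oo%E :> \bar R \/
    exists n, counting A = n%:R%:E :> \bar R.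
  by rewrite /counting; case: ifP => _; [right; eexists|left].
have [[A [n [rA cA]]]|nofin] := pselect (exists A n,
    resolving_set Z A /\ counting A = n%:R%:E :> \bar R).
  pose P n := `[< exists B, resolving_set Z B /\ counting B = n%:R%:E :> \bar R >].
  have exP : exists k, P k.
    by exists n; apply/asboolP; exists A.
  case: (ex_minnP exP) => m /asboolP[B [rB cB]] minn.
  exists B; split=> //; rewrite cB; apply/le_anti/andP; split; last first.
    by apply: ereal_inf_lbound; exists B.
  apply: le_ereal_inf_tmp => _ [C rC <-].
  have [cC|[k cC]] := countingE C; rewrite cC ?leey//.
  by rewrite lee_fin ler_nat; apply: minn; apply/asboolP; exists C.
exists Z; split; first exact: resolving_setxx.
have infE A : resolving_set Z A -> counting A = +oo%E :> \bar R.
  by move=> rA; have [//|[n cA]] := countingE A; case: nofin; exists A, n.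
rewrite (infE _ (resolving_setxx Z)); apply/le_anti/andP; split.
  by apply: le_ereal_inf_tmp => _ [A /infE-> <-].
exact: leey.
Qed.

End metric_dimension.

Section nearness.
Context {R : realType} (X : metricType R).

Definition point_nearness (x : X) : R := inf [set mdist x y | y in ~` [set x]].

Definition nearness : R := inf [set point_nearness x | x in [set: X]].

Lemma point_nearness_le (x y : X) : x <> y -> point_nearness x <= mdist x y.
Proof.
move=> xy; apply: ge_inf; first by exists 0 => _ [z _ <-]; exact: mdist_ge0.
by exists y => // yx; apply: xy.
Qed.

Lemma point_nearness_ge0 (x : X) : 0 <= point_nearness x.
Proof.
rewrite /point_nearness.
have [->|/set0P E0] := eqVneq [set mdist x y | y in ~` [set x]] set0.
  by rewrite inf0.
by apply: lb_le_inf => // _ [z _ <-]; exact: mdist_ge0.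
Qed.

Lemma nearness_le (x : X) : nearness <= point_nearness x.
Proof.
apply: ge_inf; last by exists x.
by exists 0 => _ [z _ <-]; exact: point_nearness_ge0.
Qed.

End nearness.

Section lexicographic_space.
Context {R : realType} (X Y : metricType R).

Definition lex_dist (p q : X * Y) : R :=
  if p.1 == q.1 then Num.min (2 * point_nearness p.1) (mdist p.2 q.2)
  else mdist p.1 q.1.

(* The proof argument is what makes [lex_dist] a metric. *)
Definition lex_space (hX : 0 < nearness X) : Type := (X * Y)%type.

Variable hX : 0 < nearness X.

HB.instance Definition _ := Choice.on (lex_space hX).

Let eta_gt0 x : 0 < point_nearness (x : X).
Proof. exact: lt_le_trans hX (nearness_le x). Qed.

Let lex_distxx (p : lex_space hX) : lex_dist p p = 0.
Proof.
rewrite /lex_dist eqxx mdistxx; apply/min_idPr.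
by rewrite mulr_ge0// point_nearness_ge0.
Qed.

Let lex_dist_eq0 (p q : lex_space hX) : lex_dist p q = 0 -> p = q.
Proof.
case: p q => [x y] [x' y']; rewrite /lex_dist/=; case: eqVneq => [<-|xx'].
  rewrite minEle; case: ifP => _; last by move=> /mdist_positivity ->.
  by move/eqP; rewrite mulf_eq0 pnatr_eq0/= gt_eqF.
by move=> /mdist_positivity /eqP; rewrite (negbTE xx').
Qed.

Let lex_dist_sym (p q : lex_space hX) : lex_dist p q = lex_dist q p.
Proof.
rewrite /lex_dist eq_sym; case: eqVneq => [->|_]; last exact: metric_sym.
by rewrite (metric_sym p.2).
Qed.

Let lex_dist_triangle (q p r : lex_space hX) :
  lex_dist p r <= lex_dist p q + lex_dist q r.
Proof.
case: p q r => [x y] [x' y'] [x'' y'']; rewrite /lex_dist/=.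
have e0 z : 0 <= 2 * point_nearness (z : X).
  by rewrite mulr_ge0// point_nearness_ge0.
have m0 z (a b : Y) : 0 <= Num.min (2 * point_nearness (z : X)) (mdist a b).
  by rewrite le_min e0 mdist_ge0.
have [<-|xx'] := eqVneq x x'.
  have [_|_] := eqVneq x x''; last by rewrite lerDr.
  have := metric_triangle y y' y''; have := mdist_ge0 y y'.
  have := mdist_ge0 y' y''; have := e0 x.
  by rewrite !minEle; do 3 case: ifPn; rewrite -?ltNge; lra.
have [<-|x'x''] := eqVneq x' x''.
  by rewrite (negbTE xx') lerDl.
have [xx''|_] := eqVneq x x''; last exact: metric_triangle.
rewrite -xx'' (metric_sym x').
rewrite (@le_trans _ _ (2 * point_nearness x)) ?ge_min ?lexx//.
by have /eqP/point_nearness_le := xx'; lra.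
Qed.

HB.instance Definition _ := isMetric.Build R (lex_space hX)
  lex_distxx lex_dist_eq0 lex_dist_sym lex_dist_triangle.

Definition gravitational (x : X) : set (lex_space hX) := [set p | p.1 = x].

Lemma mdist_lexE (p q : lex_space hX) : mdist p q = lex_dist p q.
Proof. by []. Qed.

End lexicographic_space.

Arguments gravitational {R X} Y hX x.

Section twins.
Context {R : realType} {X : metricType R}.
Implicit Types a b c x : X.

Definition twins a b : Prop :=
  forall c, c <> a -> c <> b -> mdist a c = mdist b c.

Definition twin_class x : set X := [set y | twins x y].

(* The common distance l_x between distinct elements of the class of x, see
   [twin_distE]; 0 by convention if the class is a singleton. *)
Definition twin_dist x : R :=
  xget 0 [set l | exists a b,
    [/\ twin_class x a, twin_class x b, a <> b & l = mdist a b]].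

Lemma twins_refl a : twins a a. Proof. by []. Qed.

Lemma twins_sym a b : twins a b -> twins b a.
Proof. by move=> ab c cb ca; rewrite ab. Qed.

Lemma twins_trans b a c : twins a b -> twins b c -> twins a c.
Proof.
move=> ab bc d da dc; have [bd|/eqP db] := eqVneq d b; last first.
  by rewrite ab// bc.
subst d; have [<-//|/eqP ac] := eqVneq a c.
rewrite metric_sym (bc a)//; last exact/nesym.
by rewrite metric_sym (ab c) ?(metric_sym b)//; exact/nesym.
Qed.

Lemma twin_distE x a b :
  twin_class x a -> twin_class x b -> a <> b -> mdist a b = twin_dist x.
Proof.
move=> xa xb ab; rewrite /twin_dist; case: xgetP => [l _|/(_ (mdist a b))];
    last by case; exists a, b.
move=> [c [d [xc xd cd ->]]].
have tw u v : twin_class x u -> twin_class x v -> twins u v.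
  by move=> xu; apply: twins_trans; exact: twins_sym.
have [bd|/eqP bd] := eqVneq b d.
  subst d; apply: (tw _ _ xa xc); exact/nesym.
have [ad|/eqP ad] := eqVneq a d.
  subst d; rewrite metric_sym.
  by apply: (tw _ _ xb xc) => //; exact/nesym.
rewrite metric_sym (tw _ _ xb xd)// metric_sym.
by apply: (tw _ _ xa xc); exact/nesym.
Qed.

End twins.

(* This is X_Y; [twin_dist x] does not depend on the member x of C, by
   [twin_distE]. *)
Definition deficient_classes {R : realType} {X : metricType R}
    (Y : metricType R) (hX : 0 < nearness X) : set (set X) :=
  [set C | [/\ exists x, C = twin_class x,
    exists a b, [/\ C a, C b & a <> b] &
    forall x, C x -> forall S : set (lex_space Y hX),
      metric_basis (gravitational Y hX x) S ->
      exists2 z, gravitational Y hX x z &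
        forall s, S s -> mdist z s = twin_dist x]].

(* Main.v *)
Require Import Defs.
From mathcomp Require Import all_boot all_order all_algebra finmap.
From mathcomp Require Import all_classical all_reals all_analysis.

Set Implicit Arguments.
Unset Strict Implicit.
Unset Printing Implicit Defensive.

Import Order.TTheory GRing.Theory Num.Theory.
Local Open Scope classical_set_scope.
Local Open Scope ring_scope.

(** Write G_x for the fibre [gravitational Y hX x]. Seen from a point outside
    G_x, all points of G_x are equally far. So two points of the same fibre can
    only be separated by points of that fibre; two points of different fibres
    G_x and G_x' are separated by any point of a third fibre G_c such that
    d(x, c) and d(x', c) differ, which exists unless x and x' are twins. For
    twins, only the points of G_x and G_x' themselves can help: u in G_x and v
    in G_x' stay confused exactly when u is at distance l_x from every chosen
    point of G_x, and v is at distance l_x from every chosen point of G_x'. Call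
    a part of G_x spherical if it lies on such a sphere of radius l_x around a
    point of G_x ([twin_sphere]). Hence A resolves the whole space if and only
    if every A `&` G_x resolves G_x and no twin class contains two points with
    spherical traces of A ([resolving_lexP]).

    The dimension is now computed fibre by fibre, since the cardinality of A is
    the sum of those of its traces. A deficient class has several points, and
    all metric bases of all fibres over it are spherical. There all traces
    except possibly one are not spherical, thus not bases; if the dimension is
    finite, they have at least one point more than a basis
    ([nonbasis_counting_ge]); adding the centre of the sphere to a basis shows
    that one more point suffices ([non_spherical_extension]). In a class with
    several points that is not deficient, some fibre has a basis that is not
    spherical; as twins have the same nearness, their fibres are isometric
    ([slide_isometry]), and this basis can be copied to all fibres of the class.

    To treat all cardinalities at once, a point r C is selected in each class C
    and the surplus of the class is spread as a 1 on every other point of a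
    deficient class; the right-hand side becomes a single sum over X
    ([esum_deficient]), compared termwise with the sizes of the traces. For the
    lower bound r depends on A: it selects the point with a spherical trace. *)

(** * Cardinality as a sum *)

Section counting_esum.
Context {R : realType}.
Local Open Scope ereal_scope.

Lemma counting_esum (T : choiceType) (A : set T) :
  counting A = \esum_(t in A) (1 : \bar R).
Proof.
have fsum (B : set T) : finite_set B ->
    \sum_(t \in B) (1 : \bar R) = (#|` fset_set B|)%:R%:E.
  move=> finB; rewrite fsbig_finite//= sumEFin.
  by rewrite big_const_seq count_predT iter_addr addr0.
rewrite /counting; case: ifPn => /asboolP finA.
  by rewrite esum_fset ?fsum// => t _; rewrite lee01.
apply/esym/eqyP => r r0.
have [B BA rB] := infinite_set_fset (Num.truncn r).+1 finA.
apply: esum_ge; exists [set` B]; first by split.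
rewrite fsum// set_fsetK lee_fin (le_trans (ltW (truncnS_gt r)))//.
by rewrite ler_nat.
Qed.

Lemma counting_pinfty_or_nat (T : choiceType) (A : set T) :
  counting A = +oo :> \bar R \/ exists n, counting A = n%:R%:E :> \bar R.
Proof. by rewrite /counting; case: ifP => _; [right; eexists|left]. Qed.

Lemma counting_ge0 (T : choiceType) (A : set T) : 0 <= counting A :> \bar R.
Proof. by rewrite counting_esum esum_ge0. Qed.

(** The pairs (f t, t) enumerate A as a disjoint union of fibres of f. *)
Lemma esum_fibers (T I : choiceType) (f : T -> I) (A : set T) (J : set I)
    (a : T -> \bar R) : (forall t, 0 <= a t) -> (forall t, A t -> J (f t)) ->
  \esum_(t in A) a t = \esum_(i in J) \esum_(t in A `&` f @^-1` [set i]) a t.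
Proof.
move=> a0 AJ; rewrite esum_esum//.
rewrite (reindex_esum A _ (fun t => (f t, t)))//; split.
- by move=> t At /=; split=> //=; exact: AJ.
- by move=> s t _ _ [].
- by move=> [i t] /= [_ [At <-]]; exists t.
Qed.

Lemma counting_setD1 (T : choiceType) (A : set T) t :
  A t -> counting A = counting (A `\ t) + 1 :> \bar R.
Proof.
move=> At; rewrite !counting_esum (esumID [set t])//.
by rewrite setIidr ?esum_set1 1?addeC// => _ ->.
Qed.

Lemma counting_setU1_le (T : choiceType) (A : set T) t :
  counting (t |` A) <= counting A + 1 :> \bar R.
Proof.
rewrite (counting_setD1 (t := t)); last by left.
rewrite leeD2r// !counting_esum [leLHS]esum_mkcond [leRHS]esum_mkcond.
apply: le_esum => s _; case: ifPn => [/set_mem|_]; last by case: ifP.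
by move=> [[]// As _]; rewrite mem_set.
Qed.

Lemma counting_image (T U : choiceType) (f : T -> U) (A : set T) :
  set_inj A f -> counting (f @` A) = counting A :> \bar R.
Proof. by move=> fi; rewrite !counting_esum esum_image. Qed.

End counting_esum.

(** * Resolving sets and isometries *)

Section isometric_images.
Context {R : realType} {T : metricType R}.
Implicit Types Z A : set T.

Lemma metric_dim_le Z A : resolving_set Z A -> (metric_dim Z <= counting A)%E.
Proof. by move=> rA; apply: ereal_inf_lbound; exists A. Qed.

Lemma metric_dim_ge0 Z : (0 <= metric_dim Z)%E.
Proof. by have [B [_ <-]] := metric_basis_exists Z; exact: counting_ge0. Qed.

(** Cardinalities are natural numbers or infinite, so exceeding the dimension
    means exceeding it by 1; a resolving set is always a basis if the dimension
    is infinite. *)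
Lemma nonbasis_counting_ge Z A : resolving_set Z A -> ~ metric_basis Z A ->
  (metric_dim Z + 1 <= counting A)%E.
Proof.
move=> rA nbA; have [B [rB cB]] := metric_basis_exists Z.
have : (metric_dim Z < counting A)%E.
  rewrite lt_neqAle metric_dim_le// andbT; apply/eqP => cA.
  by apply: nbA; split.
rewrite -cB; have [->|[m ->]] := @counting_pinfty_or_nat R _ A.
  by rewrite leey.
have [->|[n ->]] := @counting_pinfty_or_nat R _ B; first by rewrite ltNge leey.
by rewrite lte_fin ltr_nat -EFinD natr1 lee_fin ler_nat.
Qed.

Lemma resolving_setN0 Z A u v :
  resolving_set Z A -> Z u -> Z v -> u <> v -> A !=set0.
Proof.
move=> [_ rA] Zu Zv uv; apply/set0P/eqP => A0.
by apply: uv; apply: rA => // a; rewrite A0.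
Qed.

Variable f : T -> T.

Lemma isometry_inj Z :
  (forall u v, Z u -> Z v -> mdist (f u) (f v) = mdist u v) -> set_inj Z f.
Proof.
move=> fZ u v /set_mem Zu /set_mem Zv fuv; apply: (@mdist_positivity R).
by rewrite -fZ// fuv mdistxx.
Qed.

Lemma resolving_set_image Z A :
  (forall u v, Z u -> Z v -> mdist (f u) (f v) = mdist u v) ->
  resolving_set Z A ->
  resolving_set (f @` Z) (f @` A) /\ counting (f @` A) = counting A :> \bar R.
Proof.
move=> fZ [AZ rA]; split; last first.
  by apply/counting_image/isometry_inj => u v /AZ Zu /AZ; exact: fZ.
split; first exact: image_subset.
move=> _ _ [u Zu <-] [v Zv <-] fuv; congr f; apply: rA => // a Aa.
have Za := AZ _ Aa; rewrite -(fZ u a Zu Za) -(fZ v a Zv Za).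
by apply: fuv; exists a.
Qed.

Lemma metric_dim_image_le Z :
  (forall u v, Z u -> Z v -> mdist (f u) (f v) = mdist u v) ->
  (metric_dim (f @` Z) <= metric_dim Z)%E.
Proof.
move=> fZ; have [B [rB <-]] := metric_basis_exists Z.
by have [rfB <-] := resolving_set_image fZ rB; exact: metric_dim_le.
Qed.

End isometric_images.

(** * Twins *)

Section twin_nearness.
Context {R : realType} {X : metricType R}.
Implicit Types x y : X.

Lemma twins_class_eq x y : twins x y -> twin_class x = twin_class y.
Proof.
move=> xy; apply/seteqP; split=> z; apply: twins_trans => //.
exact: twins_sym.
Qed.

Lemma twins_dist_eq x y : twins x y -> twin_dist x = twin_dist y.
Proof. by move=> /twins_class_eq xy; rewrite /twin_dist xy. Qed.

Lemma mdist_twins x y : twins x y -> x <> y -> mdist x y = twin_dist x.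
Proof. by move=> xy; apply: twin_distE => //; exact: twins_refl. Qed.

(** The distances from x and from y to the other points form the same set:
    d(x, y) belongs to both, and the other distances agree. *)
Lemma twins_nearness_eq x y : twins x y -> point_nearness x = point_nearness y.
Proof.
suff sub (u v : X) : twins u v ->
    [set mdist u w | w in ~` [set u]] `<=` [set mdist v w | w in ~` [set v]].
  move=> xy; congr inf; apply/seteqP; split; apply: sub => //.
  exact: twins_sym.
move=> uv _ [w wu <-]; have [wv|/eqP wv] := eqVneq w v.
  exists u; first by rewrite -wv; exact/nesym.
  by rewrite wv metric_sym.
by exists w => //; rewrite uv.
Qed.

End twin_nearness.

(** * The fibres of the lexicographic space *)

Section lexicographic.
Context {R : realType} {X Y : metricType R} {hX : 0 < nearness X}.
Local Notation L := (lex_space Y hX).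
Local Notation G := (gravitational Y hX).
Implicit Types (x : X) (p q : L) (A S : set L) (C : set X).

Lemma mdist_lex_fibers x x' p q :
  G x p -> G x' q -> x <> x' -> mdist p q = mdist x x'.
Proof. by move=> <- <- /eqP/negbTE pq; rewrite mdist_lexE /lex_dist pq. Qed.

Definition slide x (p : L) : L := (x, p.2).

Lemma slide_gravitational x x' : slide x' @` G x = G x'.
Proof.
apply/seteqP; split=> [_ [p _ <-]//|[y z] /= <-].
by exists (x, z).
Qed.

Lemma slide_isometry x x' : twins x x' ->
  forall p q, G x p -> G x q -> mdist (slide x' p) (slide x' q) = mdist p q.
Proof.
move=> xx' p q px qx; rewrite !mdist_lexE /lex_dist /= px qx !eqxx.
by rewrite (twins_nearness_eq xx').
Qed.

(** [slide x] and [slide x'] are mutually inverse isometries between the two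
    fibres, so the dimensions of the fibres bound each other. *)
Lemma slide_basis x x' S :
  twins x x' -> metric_basis (G x) S -> metric_basis (G x') (slide x' @` S).
Proof.
move=> xx' [rS cS]; have := resolving_set_image (slide_isometry xx') rS.
rewrite slide_gravitational => -[rS' cS']; split=> //.
apply/le_anti/andP; split; last exact: metric_dim_le.
rewrite cS' cS -(slide_gravitational x' x).
exact/metric_dim_image_le/slide_isometry/twins_sym.
Qed.

(** The points of S have the same distance to z as any point of a fibre over a
    twin of x has to S: S cannot separate z from that fibre. *)
Definition twin_sphere x S : Prop :=
  exists2 z, G x z & forall s, S s -> mdist z s = twin_dist x.

Lemma slide_twin_sphere x x' S : twins x x' -> S `<=` G x ->
  twin_sphere x' (slide x' @` S) -> twin_sphere x S.
Proof.
move=> xx' SG [z zx' zS]; exists (slide x z) => // s Ss.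
rewrite (twins_dist_eq xx') -(zS (slide x' s)); last by exists s.
rewrite -(slide_isometry xx')//; last exact: SG.
by rewrite -zx'; case: z {zx' zS}.
Qed.

(** The confused pairs in different fibres are those described by two spheres
    over twins. That Y has two points ensures that a set resolving all fibres
    meets all fibres, so points of X that are not twins are separated by a third
    fibre. *)
Lemma resolving_lexP (Y2 : exists a b : Y, a <> b) A :
  resolving_set [set: L] A <->
  (forall x, resolving_set (G x) (A `&` G x)) /\
  (forall x x', twins x x' -> twin_sphere x (A `&` G x) ->
     twin_sphere x' (A `&` G x') -> x = x').
Proof.
split=> [[_ rA]|[rA tA]].
  split=> [x|x x' xx' [z zx zA] [z' z'x' z'A]].
    split=> [p [] //|u v ux vx uvA]; apply: rA => // a Aa.
    have [ax|/nesym ax] := pselect (a.1 = x); first exact: uvA.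
    by rewrite (mdist_lex_fibers ux erefl)// (mdist_lex_fibers vx erefl).
  apply: contrapT => nxx'; have : z = z'.
    apply: rA => // a Aa; have [ax|/nesym nax] := pselect (a.1 = x).
      rewrite zA// (mdist_lex_fibers z'x' ax); last exact/nesym.
      by rewrite metric_sym mdist_twins.
    have [ax'|/nesym nax'] := pselect (a.1 = x').
      by rewrite z'A// (mdist_lex_fibers zx ax')// mdist_twins//
        (twins_dist_eq xx').
    rewrite (mdist_lex_fibers zx erefl)// (mdist_lex_fibers z'x' erefl)//.
    by apply: xx'; exact/nesym.
  by move=> zz'; apply: nxx'; rewrite -zx -z'x' zz'.
split=> // u v _ _ uv.
have [uv1|nuv] := pselect (u.1 = v.1).
  by apply: (rA u.1).2 => // a [Aa _]; exact: uv.
have AN0 c : exists2 a, A a & a.1 = c.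
  have [y [y' yy']] := Y2.
  have [] := @resolving_setN0 R L _ _ (c, y) (c, y') (rA c) erefl erefl.
    by case.
  by move=> a [Aa ac]; exists a.
have tw : twins u.1 v.1.
  move=> c cu cv; have [a Aa ac] := AN0 c; have := uv _ Aa.
  rewrite (mdist_lex_fibers erefl ac); last exact/nesym.
  by rewrite (mdist_lex_fibers erefl ac); last exact/nesym.
exfalso; apply: (nuv); apply: tA => //.
  exists u => // s [As su]; rewrite uv// (mdist_lex_fibers erefl su).
    by rewrite metric_sym mdist_twins.
  exact/nesym.
exists v => // s [As sv]; rewrite -uv// (mdist_lex_fibers erefl sv)//.
by rewrite mdist_twins// (twins_dist_eq tw).
Qed.

(** A second sphere of radius l_x that contains S has the same centre, because
    S resolves; so adding this centre, at distance 0 from itself, excludes all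
    spheres. The twin x' ensures that l_x is positive. *)
Lemma non_spherical_extension x x' S : twins x x' -> x <> x' ->
  resolving_set (G x) S ->
  exists2 S', resolving_set (G x) S' &
    (counting S' <= counting S + 1 :> \bar R)%E /\ ~ twin_sphere x S'.
Proof.
move=> xx' nxx' [SG rS].
have [[z zx zS]|nS] := pselect (twin_sphere x S); last first.
  by exists S => //; split=> //; rewrite leeDl// lee01.
exists (z |` S); first split.
- by move=> p [->//|]; exact: SG.
- by move=> u v ux vx uv; apply: rS => // a Sa; apply: uv; right.
split; first exact: counting_setU1_le.
move=> [z' z'x z'S]; have z'z : z' = z.
  by apply: rS => // a Sa; rewrite zS// z'S//; right.
apply: (nxx'); apply: (@mdist_positivity R); rewrite mdist_twins//.
by rewrite -(z'S z) ?z'z ?mdistxx//; left.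
Qed.

Local Notation D := (deficient_classes Y hX).

(** The points of X whose fibre needs one point more than a basis, if r selects
    the point of each deficient class for which a basis is enough. *)
Definition surplus_points (r : set X -> X) : set X :=
  [set x | D (twin_class x) /\ x <> r (twin_class x)].

Lemma surplus_pointsE (r : set X -> X) C : D C ->
  surplus_points r `&` twin_class @^-1` [set C] = C `\ r C.
Proof.
move=> DC; apply/seteqP; split=> [x /= [[_ xr] xC]|x /= [Cx xr]].
  by rewrite -xC; split=> //; exact: twins_refl.
have xC : twin_class x = C.
  by have [[c CE] _ _] := DC; rewrite CE in Cx *; exact/esym/twins_class_eq.
by rewrite /surplus_points /= xC.
Qed.

Lemma esum_deficient (r : set X -> X) : (forall C, D C -> C (r C)) ->
  (\esum_(x in [set: X]) (metric_dim (G x) +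
      if x \in surplus_points r then 1 else 0) =
   \esum_(x in [set: X]) metric_dim (G x) +
   \esum_(C in D) (counting C - 1))%E.
Proof.
move=> rD; rewrite esumD; last 2 first.
- by move=> x _; exact: metric_dim_ge0.
- by move=> x _; case: ifP; rewrite ?lee01.
congr (_ + _)%E; rewrite -esum_mkcond.
rewrite (esum_fibers (f := twin_class) (J := D))//.
  apply: eq_esum => C DC; rewrite surplus_pointsE// -counting_esum.
  by rewrite (counting_setD1 (rD _ DC)) addeK.
by move=> x [].
Qed.

(** * Counting the points of a resolving set *)

Lemma counting_lex A :
  counting A = (\esum_(x in [set: X]) counting (A `&` G x))%E :> \bar R.
Proof.
rewrite counting_esum (esum_fibers (f := fst) (J := setT))//.
by apply: eq_esum => x _; rewrite -counting_esum.
Qed.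

(** With r selecting the only point of a class, if any, with a spherical trace,
    no trace over a surplus point is a basis: bases over a deficient class are
    all spherical. *)
Lemma metric_dim_lex_ge (x0 : X) (Y2 : exists a b : Y, a <> b) A :
  resolving_set [set: L] A ->
  (\esum_(x in [set: X]) metric_dim (G x) +
   \esum_(C in D) (counting C - 1) <= counting A)%E.
Proof.
move=> /(resolving_lexP Y2)[rA tA].
have /choice[r rP] C : exists c, D C ->
    C c /\ forall x, C x -> twin_sphere x (A `&` G x) -> x = c.
  have [DC|nDC] := pselect (D C); last by exists x0.
  have [[c CE] _ _] := DC.
  (* Twins with spherical traces coincide, so b is the only such point of C. *)
  have [[b Cb sb]|nos] := pselect (exists2 b, C b & twin_sphere b (A `&` G b)).
    exists b => _; split=> // x Cx sx; apply: tA => //.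
    by rewrite CE in Cb Cx; apply: twins_trans Cb; exact: twins_sym.
  exists c => _; split; first by rewrite CE; exact: twins_refl.
  by move=> x Cx sx; case: nos; exists x.
rewrite -(esum_deficient (r := r)) => [|C /rP[]//].
rewrite counting_lex; apply: le_esum => x _.
case: ifPn => [/set_mem[DC xr]|_]; last by rewrite adde0; exact: metric_dim_le.
apply: nonbasis_counting_ge => // bA; apply: xr.
have [_ _ /(_ x (@twins_refl _ _ x) _ bA) sA] := DC.
by apply: (rP _ DC).2 => //; exact: twins_refl.
Qed.

(** The traces of an optimal resolving set: in a class with several points, the
    last clause allows a spherical trace over the selected point only. *)
Lemma cheap_fiber (r : set X -> X) x :
  exists S, [/\ resolving_set (G x) S,
    (counting S <= metric_dim (G x) +
       if x \in surplus_points r then 1 else 0)%E &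
    forall x', twins x x' -> x <> x' -> twin_sphere x S ->
      D (twin_class x) /\ x = r (twin_class x)].
Proof.
have [B [rB cB]] := metric_basis_exists (G x).
have [[x' [xx' nxx']]|single] :=
  pselect (exists x', twins x x' /\ x <> x'); last first.
  exists B; split=> //; first by rewrite cB leeDl//; case: ifP; rewrite ?lee01.
  by move=> x' xx' nxx'; case: single; exists x'.
case: ifPn => [/set_mem[DC _]|/negP xr].
  have [S rS [cS nS]] := non_spherical_extension xx' nxx' rB.
  by exists S; split=> //; rewrite -cB.
rewrite adde0.
have [DC|nDC] := pselect (D (twin_class x)).
  exists B; split=> [||x'' _ _ _]//; first by rewrite cB.
  by split=> //; apply: contrapT => nxr; apply: xr; rewrite inE.
(* If x has a twin and all its bases are spherical, then so are all bases over
   its twins, by sliding them to x; this makes the class of x deficient. *)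
suff [S [rS cS] nS] : exists2 S, metric_basis (G x) S & ~ twin_sphere x S.
  by exists S; split=> //; rewrite cS.
apply: contrapT => noS; apply: nDC; split; first by exists x.
  by exists x, x'; split=> //; exact: twins_refl.
move=> y xy S bS; apply: contrapT => nS; apply: noS.
exists (slide x @` S); first exact/(slide_basis (twins_sym xy)).
move=> sS; apply: nS; apply: slide_twin_sphere sS; first exact: twins_sym.
by case: bS => -[].
Qed.

(** Any selection r does here: fibres over twins are isometric, so the point of
    the class that receives a spherical trace can be chosen arbitrarily. *)
Lemma metric_dim_lex_le (x0 : X) (Y2 : exists a b : Y, a <> b) :
  (metric_dim [set: L] <= \esum_(x in [set: X]) metric_dim (G x) +
   \esum_(C in D) (counting C - 1))%E.
Proof.
have /choice[r rP] C : exists c, D C -> C c.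
  have [DC|nDC] := pselect (D C); last by exists x0.
  by have [_ [c [_ [Cc _ _]]] _] := DC; exists c.
have /choice[S SP] := cheap_fiber r.
pose A : set L := [set p | S p.1 p].
have AG x : A `&` G x = S x.
  apply/seteqP; split=> [p [/= + <-]//|p Sp].
  by have [[/(_ p Sp) px _] _ _] := SP x; split=> //; rewrite /A /= px.
rewrite -(esum_deficient rP) (@le_trans _ _ (counting A))//; last first.
  by rewrite counting_lex; apply: le_esum => x _; rewrite AG; have [] := SP x.
apply/metric_dim_le/(resolving_lexP Y2); split=> [x|x x' xx'].
  by rewrite AG; have [] := SP x.
rewrite !AG => sx sx'; apply: contrapT => nxx'.
have [_ _ /(_ _ xx' nxx' sx)[_ xr]] := SP x.
have [_ _ /(_ x (twins_sym xx') (nesym nxx') sx')[_ x'r]] := SP x'.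
by apply: nxx'; rewrite xr x'r (twins_class_eq xx').
Qed.

End lexicographic.

Theorem theorem16 (R : realType) (X Y : metricType R)
    (X2 : exists a b : X, a <> b) (Y2 : exists a b : Y, a <> b)
    (hX : 0 < nearness X) :
  metric_dim [set: lex_space Y hX] =
    (\esum_(x in [set: X]) metric_dim (gravitational Y hX x) +
     \esum_(C in deficient_classes Y hX) (counting C - 1))%E.
Proof.
have [x0 _] := X2.
apply/le_anti/andP; split; first exact: (metric_dim_lex_le x0).
by apply: le_ereal_inf_tmp => _ [A rA <-]; exact: (metric_dim_lex_ge x0).
Qed.
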